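(* Let $\mu:\mathcal{P}(\mathcal{C})\to L^*$ be a capacity and $f:\mathcal{C}\to L^*$ an input vector. Then $\int_{\mathrm{DPR},\mu}^{\to_D} f=0$ if and only if $\mu^c(\{i\in\mathcal{C}\mid f_i=0\})=1$.
   Context: Residuated lattice: $L=(L,\wedge,\vee,\otimes,\to,0,1)$ is a linearly ordered residuated lattice: $(L,\wedge,\vee,0,1)$ is a linearly ordered lattice with bottom $0$ and top $1$ ($0\neq 1$), $(L,\otimes,1)$ is a commutative monoid, and $\alpha\otimes\beta\le\gamma$ iff $\alpha\le\beta\to\gamma$. The underlying ordered set of $L$ is either a closed real interval $[a,b]$ with $a<b$ or a finite subset of $[a,b]$ containing $a$ and $b$ (with $0,1$ denoting the bottom and top elements). Standing assumption: $L$ has no zero divisors with respect to $\otimes$, i.e. $\alpha\otimes\beta=0$ implies $\alpha=0$ or $\beta=0$. Dragonfly algebra: $L^*=L\cup\{*\}$ with $*\notin L$ (the ''unknown value''). Its linear order $\le_\ell$ extends the order of $L$ by $0<_\ell *<_\ell\alpha$ for all $\alpha\in L\setminus\{0\}$; $\wedge_D,\vee_D$ are the minimum and maximum with respect to $\le_\ell$, and $\bigwedge_D,\bigvee_D$ denote infimum and supremum with respect to $\le_\ell$ (with $\bigwedge_D\emptyset=1$, $\bigvee_D\emptyset=0$). The residuum $\to_D$ on $L^*$ is: $\alpha\to_D\beta=\alpha\to\beta$ for $\alpha,\beta\in L$; $\alpha\to_D *=*$ for $\alpha\in L\setminus\{0\}$; $0\to_D *=1$; $*\to_D *=1$; $*\to_D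 0=*$; $*\to_D\beta=\beta$ for $\beta\in L\setminus\{0\}$. $\mathcal{C}=\{1,\dots,n\}$ is a finite non-empty set with power set $\mathcal{P}(\mathcal{C})$. An input vector is a map $f:\mathcal{C}\to L^*$, $f_i=f(i)$. A capacity is a map $\mu:\mathcal{P}(\mathcal{C})\to L^*$ with $\mu(\emptyset)=0$, $\mu(\mathcal{C})=1$, and $A\subseteq B\Rightarrow\mu(A)\le_\ell\mu(B)$. Put $\mu^c(A)=\mu(\mathcal{C}\setminus A)\to_D 0$. The residuum-based qualitative integral is $$\int_{\mathrm{DPR},\mu}^{\to_D} f=\bigwedge_{D,\,A\subseteq\mathcal{C}}\Big(\mu^c(A)\to_D\bigvee_{D,\,i\in A}f_i\Big).$$ *)

(* Defs.v *)
From HB Require Import structures.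
From mathcomp Require Import classical_sets cardinality set_interval reals.
(* Imported last so that [set0] and the like denote finite sets. *)
From mathcomp Require Import all_boot all_order all_algebra.

Set Implicit Arguments.
Unset Strict Implicit.
Unset Printing Implicit Defensive.

Import Order.TTheory.

Local Open Scope order_scope.

Record real_chain (R : realType) := RealChain {
  rc_min : R;
  rc_max : R;
  rc_set :> set R;
  rc_lt : rc_min < rc_max;
  rc_shape :
    rc_set = `[rc_min, rc_max]%classic \/
    [/\ finite_set rc_set, (rc_set `<=` `[rc_min, rc_max])%classic,
        rc_min \in rc_set & rc_max \in rc_set] }.

Fact rc_minP (R : realType) (C : real_chain R) : rc_min C \in rc_set C.
Proof.
case: (rc_shape C) => [->|[]//]; apply/mem_set => /=.
by rewrite in_itv /= lexx ltW // rc_lt.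
Qed.

Fact rc_maxP (R : realType) (C : real_chain R) : rc_max C \in rc_set C.
Proof.
case: (rc_shape C) => [->|[]//]; apply/mem_set => /=.
by rewrite in_itv /= lexx ltW // rc_lt.
Qed.

Fact rc_bounds (R : realType) (C : real_chain R) (x : R) :
  x \in rc_set C -> rc_min C <= x <= rc_max C.
Proof.
move=> /set_mem; case: (rc_shape C) => [->|[_ sub _ _ /sub]] /=;
by rewrite in_itv.
Qed.

Fact chain_display : Order.disp_t. Proof. exact: Order.Disp tt tt. Qed.

Definition rc_elt (R : realType) (C : real_chain R) : Type :=
  {x : R | x \in rc_set C}.

Section ChainOrder.
Context (R : realType) (C : real_chain R).

HB.instance Definition _ := SubChoice.on (rc_elt C).
HB.instance Definition _ :=
  [SubChoice_isSubOrder of rc_elt C by <: with chain_display].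

Let bot : rc_elt C := exist _ (rc_min C) (rc_minP C).
Let top : rc_elt C := exist _ (rc_max C) (rc_maxP C).

Fact rc_le0x (x : rc_elt C) : bot <= x.
Proof. by rewrite leEsub /=; have /andP[] := rc_bounds (valP x). Qed.

Fact rc_lex1 (x : rc_elt C) : x <= top.
Proof. by rewrite leEsub /=; have /andP[] := rc_bounds (valP x). Qed.

HB.instance Definition _ :=
  Order.hasBottom.Build chain_display (rc_elt C) rc_le0x.
HB.instance Definition _ :=
  Order.hasTop.Build chain_display (rc_elt C) rc_lex1.

End ChainOrder.

(* The lattice operations are the minimum and maximum of the induced order. *)
Record residuated_chain (R : realType) := ResiduatedChain {
  rl_chain :> real_chain R;
  otimes : Monoid.com_law (\top : rc_elt rl_chain);
  residuum : rc_elt rl_chain -> rc_elt rl_chain -> rc_elt rl_chain;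
  residuation : forall a b c, (otimes a b <= c) = (a <= residuum b c) }.

Definition no_zero_divisors (R : realType) (L : residuated_chain R) : Prop :=
  forall a b : rc_elt L, otimes L a b = \bot -> a = \bot \/ b = \bot.

(* [None] is the unknown value [*]. *)
Definition dragonfly (R : realType) (L : residuated_chain R) : Type :=
  option (rc_elt L).

Fact dragonfly_display : Order.disp_t. Proof. exact: Order.Disp tt tt. Qed.

Section Dragonfly.
Context (R : realType) (L : residuated_chain R).
Implicit Types x y : dragonfly L.

HB.instance Definition _ := Choice.on (dragonfly L).

Definition le_dragonfly x y : bool :=
  match x, y with
  | Some a, Some b => a <= b
  | Some a, None => a == \bot
  | None, Some b => b != \bot
  | None, None => true
  end.

Fact le_dragonfly_refl : reflexive le_dragonfly.
Proof. by case=> [a|] /=. Qed.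

Fact le_dragonfly_anti : antisymmetric le_dragonfly.
Proof.
case=> [a|] [b|] //=; first by move=> /le_anti ->.
- by case: eqP.
- by rewrite andbC; case: eqP.
Qed.

Fact le_dragonfly_trans : transitive le_dragonfly.
Proof.
case=> [b|] [a|] [c|] //=; first exact: le_trans.
- by move=> ab /eqP b0; rewrite -lex0 -b0.
- by move=> b0 bc; apply: contraNneq b0 => c0; rewrite -lex0 -c0.
- by move=> /eqP -> _; rewrite le0x.
Qed.

HB.instance Definition _ :=
  Order.Le_isPOrder.Build dragonfly_display (dragonfly L)
    le_dragonfly_refl le_dragonfly_anti le_dragonfly_trans.

Fact le_dragonfly_total : total (<=%O : rel (dragonfly L)).
Proof.
case=> [a|] [b|]; rewrite /Order.le //=; first exact: le_total.
  by rewrite orbN.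
by rewrite orNb.
Qed.

HB.instance Definition _ :=
  Order.POrder_isTotal.Build dragonfly_display (dragonfly L) le_dragonfly_total.

Fact dragonfly_le0x x : (Some \bot : dragonfly L) <= x.
Proof. by case: x => [a|]; rewrite /Order.le //=; exact: le0x. Qed.

Fact dragonfly_lex1 x : x <= (Some \top : dragonfly L).
Proof.
case: x => [a|]; rewrite {1}/Order.le /=; first exact: lex1.
have := rc_lt L; apply: contraTneq => /(congr1 val) /= ->.
by rewrite ltxx.
Qed.

HB.instance Definition _ :=
  Order.hasBottom.Build dragonfly_display (dragonfly L) dragonfly_le0x.
HB.instance Definition _ :=
  Order.hasTop.Build dragonfly_display (dragonfly L) dragonfly_lex1.

Definition dragonfly_residuum x y : dragonfly L :=
  match x, y with
  | Some a, Some b => Some (residuum a b)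
  | Some a, None => if a == \bot then Some \top else None
  | None, None => Some \top
  | None, Some b => if b == \bot then None else Some b
  end.

Record capacity (n : nat) := Capacity {
  cap :> {set 'I_n} -> dragonfly L;
  cap0 : cap set0 = \bot;
  cap1 : cap [set: 'I_n] = \top;
  cap_mono : forall A B : {set 'I_n}, A \subset B -> cap A <= cap B }.

Definition co_capacity (n : nat) (mu : capacity n) (A : {set 'I_n}) :
    dragonfly L :=
  dragonfly_residuum (mu (~: A)) \bot.

Definition dpr_integral (n : nat) (mu : capacity n) (f : 'I_n -> dragonfly L) :
    dragonfly L :=
  \meet_(A : {set 'I_n})
    dragonfly_residuum (co_capacity mu A) (\join_(i in A) f i).

End Dragonfly.

(* Main.v *)
Require Import Defs.
From mathcomp Require Import all_boot all_order all_algebra.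
From mathcomp Require Import reals.

(** Without zero divisors, a residuum of [L] or of the dragonfly algebra takes
    the value [\bot] only if its left argument is a nonzero element of [L] and
    its right argument is [\bot] ([dragonfly_residuum_eq0]).  Consequently the
    negation [x ->_D 0] is either [\top], exactly when [x] is [\bot], or at most
    the unknown value ([dragonfly_neg_eq1], [dragonfly_neg_gt_unknown]).

    The order is linear, so the infimum defining the integral is [\bot] iff one
    of its finitely many terms is, say the one indexed by [A].  By the above this
    means that the complement of [A] has capacity [\bot] and that [f] vanishes on
    [A], that is, that [A] lies in the zero set of [f].  Because the capacity is
    monotone, such an [A] exists iff the largest candidate, the zero set itself,
    is one. *)

Import Order.TTheory.

Local Open Scope order_scope.

(** In a linear order a binary meet is one of its arguments, so no finite meet
    can reach [\bot] unless a term does; distinct bounds exclude the empty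
    meet. *)
Lemma meets_eq0 (d : Order.disp_t) (T : tbOrderType d) (I : finType)
    (F : I -> T) :
  (\top : T) != \bot -> (\meet_i F i == \bot) = [exists i, F i == \bot].
Proof.
move=> top0; apply/idP/idP => [|/existsP[i /eqP Fi0]]; last first.
  by rewrite -lex0 -Fi0 meets_inf.
apply: contraTT; rewrite negb_exists => /forallP F0.
elim/big_ind: _ => // x y x0 y0.
by rewrite meetEtotal minElt; case: ifP.
Qed.

Lemma joins_eq0 (d : Order.disp_t) (T : bJoinSemilatticeType d) (I : finType)
    (A : {set I}) (F : I -> T) :
  (\join_(i in A) F i == \bot) = (A \subset [set i | F i == \bot]).
Proof.
rewrite -lex0; apply/joinsP/subsetP => F0 i iA.
  by rewrite inE -lex0 F0.
by have := F0 i iA; rewrite inE => /eqP ->.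
Qed.

Section Residuum.
Context (R : realType) (L : residuated_chain R).
Implicit Types (a b c : rc_elt L) (x y : dragonfly L).

Lemma rc_top_neq0 : (\top : rc_elt L) != \bot.
Proof.
by have := rc_lt L; apply: contraTneq => /(congr1 val) /= ->; rewrite ltxx.
Qed.

Lemma otimes_le2r c a b : a <= b -> otimes L a c <= otimes L b c.
Proof.
by move=> ab; rewrite residuation (le_trans ab) // -residuation.
Qed.

Lemma le_residuum a b : b <= residuum a b.
Proof.
rewrite -residuation Monoid.mulmC /=.
by rewrite (le_trans (otimes_le2r _ _ _ (lex1 a))) // Monoid.mul1m.
Qed.

Lemma residuum0 b : residuum (\bot : rc_elt L) b = \top.
Proof.
by apply/eqP; rewrite -le1x -residuation Monoid.mul1m le0x.
Qed.

Lemma dragonfly_top_neq0 : (\top : dragonfly L) != \bot.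
Proof. exact: rc_top_neq0. Qed.

Lemma gt_unknown x : ((None : dragonfly L) < x) = (x != \bot) && (x != None).
Proof. by case: x => [a|]; rewrite lt_neqAle eq_sym andbC. Qed.

Hypothesis hL : no_zero_divisors L.

(** By residuation [a -> 0] is the largest [c] whose product with [a] is
    [\bot]; a nonzero [a] leaves only [c = \bot]. *)
Lemma residuum_eq0 a b : (residuum a b == \bot) = (a != \bot) && (b == \bot).
Proof.
have [-> | a0] /= := eqVneq a \bot; first by rewrite residuum0 (negPf rc_top_neq0).
apply/idP/idP => [/eqP ab0 | /eqP ->]; first by rewrite -lex0 -ab0 le_residuum.
have : otimes L (residuum a \bot) a == \bot by rewrite -lex0 residuation.
by move=> /eqP /hL [-> //|/eqP]; rewrite (negPf a0).
Qed.

Lemma dragonfly_residuum_eq0 x y :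
  (dragonfly_residuum x y == \bot) = ((None : dragonfly L) < x) && (y == \bot).
Proof.
rewrite gt_unknown; case: x y => [a|] [b|] /=; rewrite ?andbF ?andbT.
- exact: residuum_eq0.
- by case: (a == \bot); rewrite ?(negPf dragonfly_top_neq0).
- by case: ifPn => // b0; apply: negPf.
- exact: negPf dragonfly_top_neq0.
Qed.

Lemma dragonfly_neg_eq1 x : (dragonfly_residuum x \bot == \top) = (x == \bot).
Proof.
case: x => [a|] /=; last by rewrite eqxx.
apply/eqP/eqP => [[a1] | [->]]; last by rewrite residuum0.
congr Some; apply/eqP; apply: contraNT rc_top_neq0 => a0.
by rewrite -a1 residuum_eq0 a0 eqxx.
Qed.

(** The negation of a nonzero element of [L] is [\bot] and that of the unknown
    value is unknown, so only [\bot] has a negation above the unknown value. *)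
Lemma dragonfly_neg_gt_unknown x :
  ((None : dragonfly L) < dragonfly_residuum x \bot) = (x == \bot).
Proof.
rewrite gt_unknown dragonfly_residuum_eq0 gt_unknown eqxx andbT.
by case: x => [a|] /=; rewrite ?eqxx ?andbT ?negbK.
Qed.

End Residuum.

Theorem theorem6 (R : realType) (L : residuated_chain R)
    (hL : no_zero_divisors L) (n : nat) (hn : (0 < n)%N)
    (mu : capacity L n) (f : 'I_n -> dragonfly L) :
  dpr_integral mu f = \bot <-> co_capacity mu [set i | f i == \bot] = \top.
Proof.
set Z := [set i | f i == \bot].
have termE A : (dragonfly_residuum (co_capacity mu A) (\join_(i in A) f i)
    == \bot) = (mu (~: A) == \bot) && (A \subset Z).
  by rewrite dragonfly_residuum_eq0 // dragonfly_neg_gt_unknown // joins_eq0.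
apply: (iff_trans (rwP eqP)); apply: iff_trans (iff_sym (rwP eqP)).
rewrite meets_eq0 ?dragonfly_top_neq0 // dragonfly_neg_eq1 //.
split=> [/existsP[A] | muZ0]; last first.
  by apply/existsP; exists Z; rewrite termE muZ0 subxx.
rewrite termE => /andP[/eqP muA0 AZ].
by rewrite -lex0 -muA0 cap_mono // setCS.
Qed.
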